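(* Let $s$ be a complex number with $\Re s>1$. Then $$P_2(s)=\frac{P(2s)+P(s)^2}{2!},$$ $$P_3(s)=\frac{2P(3s)+3P(2s)P(s)+P(s)^3}{3!},$$ $$P_4(s)=\frac{6P(4s)+8P(3s)P(s)+3P(2s)^2+6P(2s)P(s)^2+P(s)^4}{4!},$$ and, in general, for every integer $k\ge 1$, $$P_k(s)=\frac{1}{k!}\sum_{\substack{k_1+2k_2+3k_3+\dotsb+kk_k=k\\ k_1,\dots,k_k\ge 0}}(k;k_1k_2\ldots k_k)^*\,P(s)^{k_1}P(2s)^{k_2}\dotsm P(ks)^{k_k},$$ where the sum is over all $k$-tuples $(k_1,\dots,k_k)$ of nonnegative integers with $\sum_{j=1}^k jk_j=k$, and $$(k;k_1k_2\ldots k_k)^*=\frac{k!}{\prod_{j=1}^k j^{k_j}\,k_j!}.$$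
   Context: For a positive integer $n$, $\Omega(n)$ is the number of prime factors of $n$ counted with multiplicity (the sum of the exponents in its prime factorization), with $\Omega(1)=0$. A $k$-almost prime is a positive integer $n$ with $\Omega(n)=k$. The prime zeta function is $P(s)=\sum_{p}p^{-s}$, the sum running over all primes $p$, for $\Re s>1$. For $k\ge 1$ the $k$-almost prime zeta function is $P_k(s)=\sum_{n\ge 1,\ \Omega(n)=k} n^{-s}$; in particular $P_1(s)=P(s)$. *)

(* Defs.v *)
(* MathComp / MathComp-Analysis; the complex numbers are R[i] for R : realType. *)
From HB Require Import structures.
From mathcomp Require Import all_boot all_order all_algebra.
From mathcomp Require Import all_classical all_reals all_analysis.
From mathcomp Require Import complex.

Set Implicit Arguments.
Unset Strict Implicit.
Unset Printing Implicit Defensive.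

Import Order.TTheory GRing.Theory Num.Theory.
Import numFieldNormedType.Exports.

Local Open Scope ring_scope.
Local Open Scope complex_scope.

Definition Omega (n : nat) : nat := (\sum_(p <- primes n) logn p n)%N.

Definition cexp (R : realType) (z : R[i]) : R[i] :=
  (expR (complex.Re z) * cos (complex.Im z)) +i*
  (expR (complex.Re z) * sin (complex.Im z)).

(* n ^ z = exp (z log n), used for n >= 1 only *)
Definition natcpow (R : realType) (n : nat) (z : R[i]) : R[i] :=
  cexp ((ln (n%:R : R))%:C * z).

(* Infinite sums are limits of partial sums in increasing order of n. The
   ascription to R[i]^o selects the topology of the complex modulus. The series
   below converge absolutely when Re s > 1; as usual, lim is unspecified for a
   divergent sequence. *)
Definition prime_zeta (R : realType) (s : R[i]) : R[i] :=
  \big[+%R/0]_(1 <= p <oo | prime p) (natcpow p (- s) : R[i]^o).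

Definition almost_prime_zeta (R : realType) (k : nat) (s : R[i]) : R[i] :=
  \big[+%R/0]_(1 <= n <oo | Omega n == k) (natcpow n (- s) : R[i]^o).

(* The component e j, with j : 'I_k counted from 0, stands for k_{j+1}. Bounding
   the components by k loses no solution, see cycle_type_bound. *)
Definition cycle_type (k : nat) (e : {ffun 'I_k -> 'I_k.+1}) : bool :=
  (\sum_(j < k) j.+1 * e j == k)%N.

Lemma cycle_type_bound (k : nat) (e : 'I_k -> nat) :
  (\sum_(j < k) j.+1 * e j = k)%N -> forall j, (e j <= k)%N.
Proof.
move=> sum_e j; rewrite -[leqRHS]sum_e (bigD1 j) //=.
by rewrite (leq_trans (leq_pmull (e j) (ltn0Sn j))) ?leq_addr.
Qed.

Definition cauchy_coef (F : fieldType) (k : nat) (e : {ffun 'I_k -> 'I_k.+1}) : F :=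
  (k`!)%:R / \prod_(j < k) (j.+1%:R ^+ e j * ((e j)`!)%:R).

(* Main.v *)
(* Fix N and let S(k) be the sum of n^-s over the n with Omega n = k all of whose
   prime factors are at most N, and Q(j) the sum of p^-js over the primes p <= N.
   Writing k = Omega n as the number of prime powers p^j > 1 dividing n and
   summing over n/p^j gives Newton's identity
     k S(k) = Q(1) S(k-1) + Q(2) S(k-2) + ... + Q(k) S(0).
   Since the sum of |n^-s| converges, S(k) tends to P_k(s) and Q(j) to P(js) as N
   grows, so that P_k(s) satisfies the same recursion. The sum over cycle types
   satisfies it as well: expand k = sum_j j k_j and use that j k_j times the term
   of (k_1, ..., k_k) is P(js) times the term with k_j decreased by one. *)
Require Import Defs.
From HB Require Import structures.
From mathcomp Require Import all_boot all_order all_algebra.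
From mathcomp Require Import all_classical all_reals all_analysis.
From mathcomp Require Import complex.
From mathcomp Require Import zify ring lra.
Import Order.TTheory GRing.Theory Num.Theory.
Import numFieldNormedType.Exports.
Local Open Scope ring_scope.
Local Open Scope classical_set_scope.
Local Open Scope complex_scope.

Set Implicit Arguments.
Unset Strict Implicit.

(** * Integers with all prime factors at most [N], and Newton's identity for their sums *)

Definition smooth (N : nat) : nat_pred := [pred p | (p <= N)%N].

(** The cut-off [N ^ k] loses nothing: a product of [k] primes, each at most [N], is at most
    [N ^ k]. *)
Definition smooth_seq (N k : nat) : seq nat :=
  [seq n <- index_iota 1 (N ^ k).+1 | (smooth N).-nat n && (Omega n == k)].

Lemma pnat_gt0 (pi : nat_pred) (n : nat) : pi.-nat n -> (0 < n)%N.
Proof. by case/andP. Qed.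

(** Gives a range of summation independent of [n], so that valuations can be added prime by prime
    and sums exchanged. *)
Lemma Omega_smooth (N n : nat) : (smooth N).-nat n ->
  Omega n = (\sum_(1 <= p < N.+1 | prime p) logn p n)%N.
Proof.
move=> smN; have n_gt0 := pnat_gt0 smN.
rewrite /Omega [RHS](bigID [in primes n]) /= [X in _ = (_ + X)%N]big1 ?addn0; last first.
  by move=> p /andP[_]; rewrite -logn_gt0 lt0n negbK => /eqP.
rewrite -[RHS]big_filter; apply/perm_big/uniq_perm.
- exact: primes_uniq.
- by rewrite !filter_uniq ?iota_uniq.
move=> p; rewrite !mem_filter mem_index_iota.
case pn: (p \in primes n); last by rewrite andbF.
rewrite andbT; move: (pn).
rewrite mem_primes => /and3P[p_pr _ pdn]; rewrite p_pr (prime_gt0 p_pr) ltnS.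
by apply/esym; case/andP: smN => _ /allP; exact.
Qed.

Lemma smooth_bound (N n : nat) : (smooth N).-nat n -> (n <= N ^ Omega n)%N.
Proof.
move=> smN; have n_gt0 := pnat_gt0 smN.
rewrite [leqLHS](prod_prime_decomp n_gt0) prime_decompE big_map /Omega expn_sum.
rewrite !big_seq; apply: leq_prod => p pn.
rewrite leq_exp2r ?logn_gt0 //; case/andP: smN => _ /allP; exact.
Qed.

Lemma mem_smooth_seq (N k n : nat) :
  (n \in smooth_seq N k) = (smooth N).-nat n && (Omega n == k).
Proof.
rewrite mem_filter mem_index_iota ltnS andbC; apply: andb_idl.
by case/andP=> smN /eqP <-; rewrite (pnat_gt0 smN) smooth_bound.
Qed.

Lemma smooth_seq_uniq (N k : nat) : uniq (smooth_seq N k).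
Proof. by rewrite filter_uniq ?iota_uniq. Qed.

Lemma smooth_seq0 (N : nat) : smooth_seq N 0 = [:: 1%N].
Proof.
apply: perm_small_eq => //; apply: uniq_perm; rewrite ?smooth_seq_uniq //.
move=> n; rewrite mem_smooth_seq !inE; apply/andP/eqP => [[smN /eqP On]|->].
  by apply/eqP; rewrite eqn_leq (pnat_gt0 smN) (leq_trans (smooth_bound smN)) ?On.
by rewrite /Omega big_nil.
Qed.

Lemma Omega_pfactor (N p j m : nat) : prime p -> (p <= N)%N ->
  (smooth N).-nat m -> Omega (p ^ j * m)%N = (j + Omega m)%N.
Proof.
move=> p_pr pN smN; have p_gt0 := prime_gt0 p_pr.
have smp : (smooth N).-nat (p ^ j * m)%N by rewrite pnatM smN andbT pnatX pnatE // inE pN.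
rewrite !(@Omega_smooth N) //.
under eq_bigr => q q_pr do
  rewrite lognM ?expn_gt0 ?p_gt0 ?(pnat_gt0 smN) // lognX logn_prime //.
rewrite big_split /=; congr (_ + _)%N.
rewrite big_mkcond (bigD1_seq p) ?iota_uniq ?mem_index_iota ?p_gt0 ?ltnS //=.
rewrite p_pr eqxx muln1 big1 ?addn0 // => q /negPf qp.
by case: ifP => // _; rewrite qp muln0.
Qed.

Lemma logn_le_Omega (p n : nat) : (logn p n <= Omega n)%N.
Proof.
have [->//|] := posnP (logn p n).
rewrite logn_gt0 => pn.
by rewrite /Omega (bigD1_seq p) ?primes_uniq //= leq_addr.
Qed.

(** For [l] the valuation of [n] at [p], the sum counts the powers [p ^ j] with [1 <= j <= k] that
    divide [n]. *)
Lemma sum_leq (l k : nat) : (\sum_(1 <= j < k.+1) (j <= l) = minn l k)%N.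
Proof.
elim: k => [|k IH]; first by rewrite big_geq // minn0.
by rewrite big_nat_recr //= IH; case: leqP => lk /=; lia.
Qed.

(** The substitution [n = p ^ j * m]: multiplication by [p ^ j] is injective, preserves smoothness
    and raises [Omega] by [j]. *)
Lemma smooth_seq_dvd (N p j k : nat) : prime p -> (p <= N)%N -> (j <= k)%N ->
  perm_eq [seq n <- smooth_seq N k | (p ^ j %| n)%N]
          [seq (p ^ j * m)%N | m <- smooth_seq N (k - j)].
Proof.
move=> p_pr pN jk; have pj_gt0 : (0 < p ^ j)%N by rewrite expn_gt0 prime_gt0.
apply: uniq_perm; first by rewrite filter_uniq ?smooth_seq_uniq.
  rewrite map_inj_uniq ?smooth_seq_uniq // => m n /eqP.
  by rewrite eqn_pmul2l // => /eqP.
move=> n; rewrite mem_filter mem_smooth_seq; apply/andP/mapP.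
  case=> /dvdnP[m ->]; rewrite mulnC pnatM -andbA => /and3P[_ smN /eqP <-].
  by exists m; rewrite // mem_smooth_seq smN (Omega_pfactor j p_pr pN smN) addKn /=.
case=> m; rewrite mem_smooth_seq => /andP[smN /eqP Om ->].
rewrite dvdn_mulr // (Omega_pfactor j p_pr pN smN) Om subnKC // eqxx andbT.
by rewrite pnatM smN andbT pnatX pnatE // inE pN.
Qed.

(** Double counting of the triples [(n, p, j)] with [p ^ j] dividing [n]: each [n] occurs
    [Omega n = k] times. *)
Lemma smooth_newton (A : comPzRingType) (f : nat -> A) (N k : nat) :
  (forall m n, (0 < m)%N -> (0 < n)%N -> f (m * n)%N = f m * f n) ->
  k%:R * \sum_(n <- smooth_seq N k) f n =
    \sum_(1 <= j < k.+1) (\sum_(1 <= p < N.+1 | prime p) f (p ^ j)%N) *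
                         \sum_(n <- smooth_seq N (k - j)) f n.
Proof.
move=> fM; rewrite mulr_sumr.
transitivity (\sum_(n <- smooth_seq N k) \sum_(1 <= j < k.+1)
    \sum_(1 <= p < N.+1 | prime p) if (p ^ j %| n)%N then f n else 0).
  rewrite big_seq [RHS]big_seq; apply: eq_bigr => n.
  rewrite mem_smooth_seq => /andP[smN /eqP On].
  rewrite exchange_big /= -[X in X%:R]On (Omega_smooth smN) natr_sum mulr_suml.
  apply: eq_bigr => p p_pr; rewrite -big_mkcond /= mulr_natl.
  rewrite big_const_seq iter_addr_0; congr (_ *+ _); rewrite -sum1_count.
  rewrite big_mkcond /=.
  (* No power of [p] dividing [n] is lost by stopping at [j = k]. *)
  have logk : (logn p n <= k)%N by rewrite -On logn_le_Omega.
  rewrite -[LHS](minn_idPl logk) -sum_leq; apply: eq_bigr => j _.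
  by rewrite pfactor_dvdn ?(pnat_gt0 smN) //; case: leqP.
rewrite exchange_big big_nat [RHS]big_nat; apply: eq_bigr => j /andP[_].
rewrite ltnS => jk.
rewrite exchange_big /= mulr_suml big_seq_cond [RHS]big_seq_cond.
apply: eq_bigr => p; rewrite mem_index_iota !ltnS => /andP[/andP[_ pN] p_pr].
rewrite -big_mkcond /= -[LHS]big_filter (perm_big _ (smooth_seq_dvd p_pr pN jk)).
rewrite big_map mulr_sumr big_seq [RHS]big_seq; apply: eq_bigr => m.
rewrite mem_smooth_seq => /andP[/pnat_gt0 m_gt0 _].
by rewrite fM // expn_gt0 prime_gt0.
Qed.

(** * Newton's identity for sums over cycle types *)

(* The recursion relates cycle types of different weights, so the bound M on
   indices and entries is kept independent of the weight. *)
Definition weight (M : nat) (e : {ffun 'I_M -> 'I_M.+1}) : nat :=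
  (\sum_(j < M) j.+1 * e j)%N.

(** The [k!] of the Cauchy coefficient is left out, since it cancels against the prefactor [1 / k!]
    and would obscure the relation between different weights. *)
Definition cycle_term (F : fieldType) (M : nat) (q : nat -> F)
    (e : {ffun 'I_M -> 'I_M.+1}) : F :=
  \prod_(j < M) (q j.+1 ^+ e j / (j.+1%:R ^+ e j * ((e j)`!)%:R)).

(* Junk when e i = M: inord M.+1 is 0. *)
Definition incr (M : nat) (i : 'I_M) (e : {ffun 'I_M -> 'I_M.+1}) :
    {ffun 'I_M -> 'I_M.+1} :=
  [ffun j => if j == i then inord (e j).+1 else e j].

Definition decr (M : nat) (i : 'I_M) (e : {ffun 'I_M -> 'I_M.+1}) :
    {ffun 'I_M -> 'I_M.+1} :=
  [ffun j => if j == i then inord (e j).-1 else e j].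

Lemma decrK (M : nat) (i : 'I_M) (e : {ffun 'I_M -> 'I_M.+1}) :
  (0 < e i)%N -> incr i (decr i e) = e.
Proof.
move=> ei; apply/ffunP => j; rewrite !ffunE; case: eqP => // ->.
by apply: val_inj; rewrite /= !inordK ?prednK ?ltnS //; have := ltn_ord (e i); lia.
Qed.

Lemma incrK (M : nat) (i : 'I_M) (e : {ffun 'I_M -> 'I_M.+1}) :
  (e i < M)%N -> decr i (incr i e) = e.
Proof.
move=> ei; apply/ffunP => j; rewrite !ffunE; case: eqP => // ->.
by apply: val_inj; rewrite /= !inordK ?ltnS //= ltnW.
Qed.

(** When [e i = M], the default value 0 of [inord] makes both sides false. *)
Lemma incr_gt0 (M : nat) (i : 'I_M) (e : {ffun 'I_M -> 'I_M.+1}) :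
  (0 < incr i e i)%N = (e i < M)%N.
Proof.
rewrite ffunE eqxx /inord val_insubd !ltnS.
by case: (e i < M)%N.
Qed.

Lemma weight_incr (M : nat) (i : 'I_M) (e : {ffun 'I_M -> 'I_M.+1}) :
  (e i < M)%N ->
  weight (incr i e) = (i.+1 + weight e)%N.
Proof.
move=> ei; rewrite /weight (bigD1 i) //= [in RHS](bigD1 i) //= ffunE eqxx.
rewrite inordK ?ltnS // mulnS addnA; congr (_ + _)%N.
by apply: eq_bigr => j /negPf ji; rewrite ffunE ji.
Qed.

(** Only the factor at [i] changes: it gains [q i.+1] over [i.+1 * (e i).+1]. *)
Lemma cycle_term_incr (F : numFieldType) (M : nat) (q : nat -> F) (i : 'I_M)
    (e : {ffun 'I_M -> 'I_M.+1}) :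
  (e i < M)%N ->
  (i.+1 * (e i).+1)%:R * cycle_term q (incr i e) = q i.+1 * cycle_term q e.
Proof.
move=> ei; rewrite /cycle_term (bigD1 i) //= [in RHS](bigD1 i) //= ffunE eqxx.
rewrite inordK ?ltnS // !mulrA; congr (_ * _); last first.
  by apply: eq_bigr => j /negPf ji; rewrite ffunE ji.
rewrite factS !natrM !exprS; field.
by rewrite expf_neq0 ?pnatr_eq0 -?natr1 ?[1 + _]addrC ?natr1 ?pnatr_eq0 -?lt0n ?fact_gt0.
Qed.

Lemma weight_part (M : nat) (i : 'I_M) (e : {ffun 'I_M -> 'I_M.+1}) (k : nat) :
  weight e = k -> (i.+1 * e i <= k)%N.
Proof. by move<-; rewrite /weight (bigD1 i) //= leq_addr. Qed.

Lemma cycle_sum_newton (F : numFieldType) (M k : nat) (q : nat -> F) : (k <= M)%N ->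
  k%:R * \sum_(e | weight e == k) @cycle_term F M q e =
    \sum_(1 <= j < k.+1) q j * \sum_(e | weight e == (k - j)%N) @cycle_term F M q e.
Proof.
move=> kM; pose H j := \sum_(e | weight e == j) @cycle_term F M q e.
rewrite -/(H k) (eq_bigr (fun j => q j * H (k - j)%N)) // mulr_sumr.
transitivity (\sum_(i < M) \sum_(e : {ffun 'I_M -> 'I_M.+1} | weight e == k)
    (i.+1 * e i)%:R * cycle_term q e).
  rewrite exchange_big; apply: eq_bigr => e /eqP <-.
  by rewrite -mulr_suml /weight natr_sum.
(* The right-hand sum is reindexed by [j = i.+1] and widened from [i < k] to [i < M]; the left-hand
   terms with [k <= i] vanish because no part exceeds the weight. *)
rewrite big_add1 /= big_mkord (big_ord_widen M (fun j => q j.+1 * H (k - j.+1)%N)) //.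
rewrite [RHS]big_mkcond; apply: eq_bigr => i _ /=; case: ltnP => ik; last first.
  rewrite big1 // => e /eqP we; have := weight_part i we.
  have [->|ei] := posnP (e i); first by rewrite muln0 mul0r.
  by rewrite leqNgt (leq_trans _ (leq_pmulr _ ei)).
rewrite (bigID (fun e : {ffun 'I_M -> 'I_M.+1} => (0 < e i)%N)) /=.
rewrite [X in _ + X]big1 ?addr0; last first.
  by move=> e /andP[_]; rewrite -eqn0Ngt => /eqP ->; rewrite muln0 mul0r.
rewrite (reindex_onto (incr i) (decr i)) /=; last by move=> e /andP[_]; exact: decrK.
rewrite mulr_sumr; apply: eq_big => [e|e]; rewrite incr_gt0.
  (* If [e i = M], both conditions fail: [incr i e] drops to 0 at [i], and a weight of at least
     [i.+1 * M] exceeds [k - i.+1] because [k <= M]. *)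
  case: (ltnP (e i) M) => eM; last first.
    by rewrite andbF; apply/esym/eqP => /(weight_part i); nia.
  by rewrite weight_incr // incrK // eqxx !andbT; apply/eqP/eqP; lia.
move=> /andP[/andP[_ eM] _].
by rewrite -cycle_term_incr // ffunE eqxx inordK.
Qed.

(** * The complex exponential and the powers [n ^ z] *)

Lemma cexpD (R : realType) (z w : R[i]) : cexp (z + w) = cexp z * cexp w.
Proof.
case: z w => [a b] [c d]; rewrite /cexp /= expRD cosD sinD; simpc.
by congr Complex; ring.
Qed.

Lemma cexp0 (R : realType) : cexp (0 : R[i]) = 1.
Proof. by rewrite /cexp /= expR0 cos0 sin0 mulr1 mulr0. Qed.

Lemma norm_cexp (R : realType) (z : R[i]) : `|cexp z| = (expR (complex.Re z))%:C.
Proof.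
rewrite normc_def /= !exprMn -mulrDr cos2Dsin2 mulr1 sqrtr_sqr ger0_norm ?expR_ge0 //.
Qed.

Lemma cexpMn (R : realType) (z : R[i]) (n : nat) : cexp (n%:R * z) = cexp z ^+ n.
Proof.
elim: n => [|n IH]; first by rewrite mul0r cexp0.
by rewrite -natr1 mulrDl mul1r cexpD IH exprSr.
Qed.

Section Dirichlet.
Variables (R : realType) (s : R[i]).

Lemma natcpow1 : natcpow 1 s = 1.
Proof. by rewrite /natcpow ln1 mul0r cexp0. Qed.

Lemma natcpowM (m n : nat) : (0 < m)%N -> (0 < n)%N ->
  natcpow (m * n) s = natcpow m s * natcpow n s.
Proof.
move=> m0 n0; rewrite /natcpow natrM lnM ?posrE ?ltr0n // -cexpD -mulrDl.
by rewrite rmorphD.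
Qed.

(** This identifies the power sums over [p ^ j] with partial sums of the prime zeta function at
    [j s]. *)
Lemma natcpowX (m k : nat) : (0 < m)%N ->
  natcpow (m ^ k) s = natcpow m (k%:R * s).
Proof.
move=> m0; rewrite [RHS]/natcpow mulrCA cexpMn -/(natcpow m s).
by elim: k => [|k IH]; rewrite ?natcpow1 // expnS natcpowM ?expn_gt0 ?m0 // IH exprS.
Qed.

Lemma norm_natcpow (n : nat) : `|natcpow n s| = (expR (ln (n%:R : R) * complex.Re s))%:C.
Proof. by rewrite norm_cexp; case: s => a b; simpc. Qed.

End Dirichlet.

(** * Bounds for real Dirichlet series and limits in the complex plane *)

Lemma nondecreasing_sum (R : realType) (v : nat -> R) : (forall n, 0 <= v n) ->
  {homo (fun N => \sum_(1 <= n < N) v n) : m n / (m <= n)%N >-> m <= n}.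
Proof.
move=> v0 [|m] n mn; first by rewrite big_geq // sumr_ge0.
case: n mn => // n mn.
by rewrite [leRHS](@big_cat_nat _ _ _ m.+1) //= lerDl sumr_ge0.
Qed.

(* As f decreases and f(2n) = f(2) f(n), the partial sums T of f satisfy
   T <= 1 + 2 f(2) T, with 2 f(2) = 2^(1-x) < 1. *)
Lemma zeta_bound (R : realType) (x : R) : 1 < x ->
  exists B, forall N, \sum_(1 <= n < N) expR (ln (n%:R : R) * - x) <= B.
Proof.
move=> x1; pose f n := expR (ln (n%:R : R) * - x).
have f_ge0 n : 0 <= f n by exact: expR_ge0.
have fM m n : (0 < m)%N -> (0 < n)%N -> f (m * n)%N = f m * f n.
  by move=> m0 n0; rewrite /f natrM lnM ?posrE ?ltr0n // mulrDl expRD.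
have f_le m n : (0 < m)%N -> (m <= n)%N -> f n <= f m.
  move=> m0 mn; rewrite /f ler_expR ler_nM2r ?oppr_lt0 ?(lt_trans _ x1) //.
  by rewrite ler_ln ?posrE ?ltr0n ?ler_nat // (leq_trans m0).
have f2 : 2 * f 2%N < 1.
  rewrite /f -[ltLHS]/(2 * expR (ln 2 * - x)).
  have ln2 : 0 < ln (2 : R) by rewrite ln_gt0 // ltr1n.
  rewrite -[X in X * _]lnK ?posrE // -expRD expR_lt1.
  by rewrite -[X in X + _]mulr1 -mulrDr pmulr_rlt0 // subr_lt0.
have T_le N : \sum_(1 <= n < N.+1) f n <= 1 + 2 * f 2%N * \sum_(1 <= n < N.+1) f n.
  (* The terms [2m] and [2m + 1] are each at most [f 2 * f m]; the term 1 accounts for the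
     constant. *)
  have split M : \sum_(1 <= n < M.*2.+2) f n
      <= 1 + 2 * f 2%N * \sum_(1 <= n < M.+1) f n.
    elim: M => [|M IH].
      by rewrite big_nat1 big_geq // mulr0 addr0 /f ln1 mul0r expR0.
    rewrite doubleS big_nat_recr //= big_nat_recr //= [in leRHS]big_nat_recr //=.
    have := f_le (2 * M.+1)%N (2 * M.+1).+1 isT (leqnSn _).
    have <- : M.*2.+2 = (2 * M.+1)%N by lia.
    have -> : f M.*2.+2 = f 2%N * f M.+1 by rewrite -fM //; congr f; lia.
    move: IH; nra.
  apply: le_trans (split N); apply: nondecreasing_sum => //; lia.
exists ((1 - 2 * f 2%N)^-1) => -[|N].
  by rewrite big_geq // invr_ge0; lra.
rewrite -[leLHS]/(\sum_(1 <= n < N.+1) f n).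
rewrite -div1r ler_pdivlMr; last by lra.
have := T_le N; lra.
Qed.

(** The order on [R[i]] only compares numbers with equal imaginary parts, so every epsilon in a
    complex limit is real. *)
Lemma gt0_complex (R : realType) (z : R[i]) : 0 < z ->
  exists2 e : R, 0 < e & z = e%:C.
Proof.
move=> z0; exists (complex.Re z); first by move: z0; rewrite ltcE => /andP[].
by rewrite RRe_real // gtr0_real.
Qed.

Lemma cvg_complex (R : realType) (u : nat -> R[i]^o) (l : R[i]^o) :
  (fun n => complex.Re (u n)) @ \oo --> complex.Re l ->
  (fun n => complex.Im (u n)) @ \oo --> complex.Im l ->
  u @ \oo --> l.
Proof.
move=> /cvgrPdist_lt ure /cvgrPdist_lt uim.
apply/cvgrPdist_lt => eps eps0.
have [e e0 ->] := gt0_complex eps0.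
have e2 : 0 < e / 2 by rewrite divr_gt0.
near=> n; rewrite [l - u n]complexE.
apply: le_lt_trans (ler_normD _ _) _; rewrite normrM.
have -> : `|'i%C : R[i]| = 1 by rewrite normc_def /= expr0n expr1n add0r sqrtr1.
rewrite mul1r !normc_def /= expr0n !addr0 !sqrtr_sqr -rmorphD ltcR.
rewrite [e]splitr !raddfB; apply: ltrD.
- by near: n; exact: ure.
- by near: n; exact: uim.
Unshelve. all: by end_near. Qed.

(** * Uniqueness of the solution of Newton's recursion *)

Lemma cycle_sum0 (F : numFieldType) (M : nat) (q : nat -> F) :
  \sum_(e | weight e == 0%N) @cycle_term F M q e = 1.
Proof.
rewrite (big_pred1 [ffun=> ord0]) => [|e].
  by rewrite /cycle_term big1 // => j _; rewrite ffunE !expr0 fact0 mulr1 divr1.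
apply/eqP/eqP => [we|->].
  by apply/ffunP => j; rewrite ffunE; apply/val_inj => /=; have := weight_part j we; nia.
by rewrite /weight big1 // => j _; rewrite ffunE muln0.
Qed.

(** Strong induction: both sides have initial value 1 and satisfy the same recursion, in which the
    factor [k.+1] can be cancelled. *)
Lemma newton_cycle_sum (F : numFieldType) (M : nat) (q h : nat -> F) :
  h 0%N = 1 ->
  (forall k, k%:R * h k = \sum_(1 <= j < k.+1) q j * h (k - j)%N) ->
  forall k, (k <= M)%N -> h k = \sum_(e | weight e == k) @cycle_term F M q e.
Proof.
move=> h0 hN; elim/ltn_ind => -[_ _|k IH kM]; first by rewrite h0 cycle_sum0.
apply: (@mulfI _ k.+1%:R); first by rewrite pnatr_eq0.
rewrite hN cycle_sum_newton // big_nat [RHS]big_nat.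
by apply: eq_bigr => j /andP[j1 jk]; rewrite IH //; lia.
Qed.

(** * Dominated series and the tail estimate for smooth sums *)

(** Writing [w = (w + v) - v] gives a difference of two nonnegative series with partial sums bounded
    by [B + B] and [B]. *)
Lemma is_cvg_series_dominated (R : realType) (w v : nat -> R) (B : R) :
  (forall n, `|w n| <= v n) -> (forall N, \sum_(1 <= n < N) v n <= B) ->
  cvgn (fun N => \sum_(1 <= n < N) w n).
Proof.
move=> wv vB.
have incr_cvg (u : nat -> R) C : (forall n, 0 <= u n) ->
    (forall N, \sum_(1 <= n < N) u n <= C) -> cvgn (fun N => \sum_(1 <= n < N) u n).
  move=> u0 uC; apply: nondecreasing_is_cvgn (nondecreasing_sum u0) _.
  by exists C => _ [N _ <-].
have v0 n : 0 <= v n by exact: le_trans (wv n).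
have -> : (fun N => \sum_(1 <= n < N) w n) =
    (fun N => \sum_(1 <= n < N) (w n + v n) - \sum_(1 <= n < N) v n).
  by apply/funext => N; rewrite big_split /= addrK.
apply: is_cvgB; last exact: incr_cvg vB.
apply: (@incr_cvg _ (B + B)) => [n|N].
  by have := wv n; rewrite ler_norml => /andP[? _]; lra.
rewrite big_split /= lerD // (le_trans _ (vB N)) // ler_sum // => n _.
exact: le_trans (ler_norm _) (wv n).
Qed.

Lemma cvg_complexM (R : realType) (u w : nat -> R[i]^o) (l m : R[i]^o) :
  u @ \oo --> l -> w @ \oo --> m ->
  ((fun n => u n * w n) : nat -> R[i]^o) @ \oo --> (l * m : R[i]^o).
Proof. by move=> ul wm; exact: (@cvgM R[i] nat _ _ u w l m ul wm). Qed.

Lemma is_cvg_complex_series (R : realType) (u : nat -> R[i]) (v : nat -> R)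
    (B : R) (P : pred nat) :
  (forall n, P n -> `|u n| <= (v n)%:C) -> (forall n, 0 <= v n) ->
  (forall N, \sum_(1 <= n < N) v n <= B) ->
  cvgn (fun N => \sum_(1 <= n < N | P n) (u n : R[i]^o)).
Proof.
move=> uv v0 vB; pose w n := if P n then u n else 0.
have wv n : `|w n| <= (v n)%:C.
  by rewrite /w; case: ifP => [/uv//|_]; rewrite normr0 lecR.
(* Here [g] stands for the real or the imaginary part, both additive and bounded by the modulus. *)
have cvg_part (g : R[i] -> R) : g 0 = 0 -> {morph g : x y / x + y} ->
    (forall z, `|g z|%:C <= `|z|) ->
    cvgn (fun N => g (\sum_(1 <= n < N | P n) u n)).
  move=> g0 gD gz; under eq_fun do rewrite big_mkcond (big_morph g gD g0).
  apply: is_cvg_series_dominated vB => n; rewrite -lecR.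
  exact: le_trans (gz _) (wv n).
have norm_ge_Im (z : R[i]) : `|complex.Im z|%:C <= `|z|.
  by rewrite normc_def lecR -sqrtr_sqr ler_wsqrtr // lerDr sqr_ge0.
have ReD : {morph @complex.Re R : x y / x + y} by move=> [? ?] [? ?].
have ImD : {morph @complex.Im R : x y / x + y} by move=> [? ?] [? ?].
have cre := cvg_part _ erefl ReD (@normc_ge_Re R).
have cim := cvg_part _ erefl ImD norm_ge_Im.
apply/cvg_ex; eexists (Complex _ _).
apply: cvg_complex; [exact: cre | exact: cim].
Qed.

(** Every positive [n <= N] is smooth, so the two sums agree up to [N] and differ only by smooth
    terms beyond [N]. *)
Lemma smooth_seq_tail (R : realType) (u : nat -> R[i]) (v : nat -> R) (N k : nat) :
  (forall n, `|u n| <= (v n)%:C) -> (forall n, 0 <= v n) ->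
  (* The bound [K] is taken above [N ^ k], to cover the smooth list, and above [N], so that the
     range can be cut after [N] even for [k = 0]. *)
  exists K,
   `|\sum_(n <- smooth_seq N k) u n - \sum_(1 <= n < N.+1 | Omega n == k) u n|
     <= (\sum_(1 <= n < K) v n - \sum_(1 <= n < N.+1) v n)%:C.
Proof.
move=> uv v0; exists (N ^ k + N).+1.
pose P n := (smooth N).-nat n && (Omega n == k).
have -> : \sum_(n <- smooth_seq N k) u n = \sum_(1 <= n < (N ^ k + N).+1 | P n) u n.
  rewrite -[RHS]big_filter; apply/perm_big/uniq_perm.
  - exact: smooth_seq_uniq.
  - by rewrite filter_uniq ?iota_uniq.
  move=> n; rewrite mem_smooth_seq mem_filter -/(P n) andb_idr //.
  rewrite /P -mem_smooth_seq mem_filter !mem_index_iota => /andP[_]; lia.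
rewrite !(@big_cat_nat _ _ _ N.+1 1 (N ^ k + N).+1) ?ltnS ?leq_addl //=.
rewrite [X in X + _ - _](_ : _ = \sum_(1 <= n < N.+1 | Omega n == k) u n).
  rewrite ![_ + _ - _]addrAC !subrr !add0r rmorph_sum big_mkcond /=.
  apply: le_trans (ler_norm_sum _ _ _) _; apply: ler_sum => n _.
  by case: ifP => // _; rewrite normr0 lecR.
rewrite big_nat_cond [RHS]big_nat_cond; apply: eq_bigl => n.
case: (boolP (0 < n < N.+1)%N) => //= /andP[n0 nN]; rewrite /P.
by apply/andb_idl => _; apply/(pnatP _ n0) => p _ /(dvdn_leq n0); rewrite inE; lia.
Qed.

(** * Passage to the limit in Newton's identity *)

Section Limits.
Variables (R : realType) (s : R[i]).
Hypothesis s_gt1 : 1 < complex.Re s.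

Let a (n : nat) : R[i] := natcpow n (- s).
Let v (n : nat) : R := expR (ln n%:R * - complex.Re s).

Let norm_a (n : nat) : `|a n| = (v n)%:C.
Proof.
rewrite norm_natcpow.
by have -> : complex.Re (- s) = - complex.Re s by case: (s).
Qed.

Let v_ge0 (n : nat) : 0 <= v n. Proof. exact: expR_ge0. Qed.

Let aM (m n : nat) : (0 < m)%N -> (0 < n)%N -> a (m * n)%N = a m * a n.
Proof. exact: natcpowM. Qed.

(** Since [p <= p ^ j], the series is dominated by that of [n] to the power [- Re s]. Convergence
    suffices, the value being a limit of partial sums by definition. *)
Lemma cvg_prime_zeta (j : nat) : (0 < j)%N ->
  (fun N => \sum_(1 <= p < N.+1 | prime p) (a (p ^ j)%N : R[i]^o)) @ \oo -->
  (prime_zeta (j%:R * s) : R[i]^o).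
Proof.
move=> j0; have [B vB] := zeta_bound s_gt1.
have ajE p : prime p -> a (p ^ j)%N = natcpow p (- (j%:R * s)).
  by move=> /prime_gt0 p0; rewrite /a natcpowX // mulrN.
have v_le p : prime p -> v (p ^ j) <= v p.
  move=> /prime_gt0 p0; rewrite ler_expR ler_nM2r ?oppr_lt0 ?(lt_trans _ s_gt1) //.
  by rewrite ler_ln ?posrE ?ltr0n ?expn_gt0 ?p0 // ler_nat -[leqLHS]expn1 leq_pexp2l.
rewrite /prime_zeta.
rewrite (cvg_shiftS (fun N => \sum_(1 <= p < N | prime p) (a (p ^ j)%N : R[i]^o))).
under eq_fun do under eq_bigr => p pp do rewrite ajE //.
apply: is_cvg_complex_series vB => // p pp.
by rewrite -ajE // norm_a lecR v_le.
Qed.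

(** The smooth sums [S] and the ordinary partial sums [D] differ by at most a tail of a convergent
    series. *)
Lemma cvg_almost_prime_zeta (k : nat) :
  (fun N => \sum_(n <- smooth_seq N k) (a n : R[i]^o)) @ \oo -->
  (almost_prime_zeta k s : R[i]^o).
Proof.
have [B vB] := zeta_bound s_gt1.
pose V N := \sum_(1 <= n < N) v n.
have V_incr := nondecreasing_sum v_ge0 : nondecreasing_seq V.
have V_cvg : cvgn V.
  by apply: nondecreasing_is_cvgn V_incr _; exists B => _ [N _ <-]; exact: vB.
pose D N := \sum_(1 <= n < N.+1 | Omega n == k) (a n : R[i]^o).
have D_cvg : D @ \oo --> (almost_prime_zeta k s : R[i]^o).
  rewrite /D (cvg_shiftS (fun N => \sum_(1 <= n < N | Omega n == k) (a n : R[i]^o))).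
  by apply: is_cvg_complex_series vB => // n _; rewrite norm_a.
pose S N := \sum_(n <- smooth_seq N k) (a n : R[i]^o).
rewrite -/S; apply: (@cvg_sub0 _ (R[i]^o) _ _ _ S D _ _ D_cvg).
have V_cvg0 : (limn V - V N.+1) @[N --> \oo] --> (0 : R).
  rewrite -[X in _ --> X](subrr (limn V)).
  by apply: cvgB; [exact: cvg_cst | rewrite (cvg_shiftS V)].
apply/cvgrPdist_lt => eps eps0.
have [e e0 ->] := gt0_complex eps0.
near=> N; rewrite sub0r normrN.
have a_le n : `|a n| <= (v n)%:C by rewrite norm_a.
have [K] := smooth_seq_tail N k a_le v_ge0.
move=> /le_lt_trans; apply; rewrite ltcR.
(* Replacing the partial sum up to [K] by the limit of [V] removes the dependence on [K], which
   varies with [N]. *)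
apply: le_lt_trans (_ : limn V - V N.+1 < e).
  by rewrite lerD2r; exact: nondecreasing_cvgn_le.
apply: le_lt_trans (ler_norm _) _; rewrite -normrN -sub0r.
by near: N; move/cvgrPdist_lt: V_cvg0; exact.
Unshelve. all: by end_near. Qed.

Lemma almost_prime_zeta_newton (k : nat) :
  k%:R * almost_prime_zeta k s =
    \sum_(1 <= j < k.+1) prime_zeta (j%:R * s) * almost_prime_zeta (k - j)%N s.
Proof.
pose S m N : R[i]^o := \sum_(n <- smooth_seq N m) a n.
pose Q j N : R[i]^o := \sum_(1 <= p < N.+1 | prime p) a (p ^ j)%N.
have cvg_l : (fun N => k%:R * S k N : R[i]^o) @ \oo -->
    (k%:R * almost_prime_zeta k s : R[i]^o).
  exact: (cvg_complexM (cvg_cst _) (@cvg_almost_prime_zeta k)).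
have cvg_r : (fun N => \sum_(1 <= j < k.+1) Q j N * S (k - j)%N N : R[i]^o) @ \oo -->
    (\sum_(1 <= j < k.+1) prime_zeta (j%:R * s) * almost_prime_zeta (k - j)%N s : R[i]^o).
  rewrite big_nat; under eq_fun do rewrite big_nat.
  apply: (@cvg_big (R[i]^o)) => [|j /andP[j0 _]]; first exact: add_continuous.
  exact: (cvg_complexM (@cvg_prime_zeta _ j0) (@cvg_almost_prime_zeta (k - j)%N)).
apply: (cvg_unique (@norm_hausdorff _ R[i]^o) cvg_l).
suff -> : (fun N => k%:R * S k N : R[i]^o) =
  (fun N => \sum_(1 <= j < k.+1) Q j N * S (k - j)%N N : R[i]^o) by [].
apply/funext => N; exact: smooth_newton.
Qed.

Lemma almost_prime_zeta0 : almost_prime_zeta 0 s = 1.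
Proof.
apply: (cvg_unique (@norm_hausdorff _ R[i]^o) (@cvg_almost_prime_zeta 0)).
suff -> : (fun N => \sum_(n <- smooth_seq N 0) (a n : R[i]^o)) = fun=> (1 : R[i]^o).
  exact: cvg_cst.
by apply/funext => N; rewrite smooth_seq0 big_seq1 /a natcpow1.
Qed.

(** With [M = k], the condition [weight e == k] is [cycle_type e] by definition. *)
Lemma almost_prime_zeta_cycle_sum (k : nat) :
  almost_prime_zeta k s =
    (k`!%:R)^-1 *
    \sum_(e : {ffun 'I_k -> 'I_k.+1} | cycle_type e)
      (cauchy_coef R[i] e * \prod_(j < k) prime_zeta (j.+1%:R * s) ^+ e j).
Proof.
rewrite (@newton_cycle_sum _ k (fun j => prime_zeta (j%:R * s))
  (fun j => almost_prime_zeta j s)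
  almost_prime_zeta0 almost_prime_zeta_newton k (leqnn k)).
rewrite mulr_sumr; apply: eq_bigr => e _.
by rewrite /cycle_term prodf_div /cauchy_coef !mulrA mulVf ?mul1r 1?mulrC.
Qed.

End Limits.

(** * The explicit formulas for [k = 2, 3, 4] and the general formula *)

Theorem theorem1 (R : realType) (s : R[i]) (hs : 1 < complex.Re s) :
  [/\ almost_prime_zeta 2 s =
        (prime_zeta (2 * s) + prime_zeta s ^+ 2) / (2`!)%:R,
      almost_prime_zeta 3 s =
        (2 * prime_zeta (3 * s) + 3 * prime_zeta (2 * s) * prime_zeta s
         + prime_zeta s ^+ 3) / (3`!)%:R,
      almost_prime_zeta 4 s =
        (6 * prime_zeta (4 * s) + 8 * prime_zeta (3 * s) * prime_zeta s
         + 3 * prime_zeta (2 * s) ^+ 2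
         + 6 * prime_zeta (2 * s) * prime_zeta s ^+ 2
         + prime_zeta s ^+ 4) / (4`!)%:R
    & forall k : nat, (1 <= k)%N ->
      almost_prime_zeta k s =
        ((k`!)%:R)^-1 *
        \sum_(e : {ffun 'I_k -> 'I_k.+1} | cycle_type e)
          (cauchy_coef R[i] e * \prod_(j < k) prime_zeta (j.+1%:R * s) ^+ e j)].
Proof.
have P0 := almost_prime_zeta0 hs.
(* Solved for the highest index, the recursion yields the cases 2, 3 and 4 successively, with no
   enumeration of cycle types. *)
have newton k : almost_prime_zeta k.+1 s = (k.+1%:R)^-1 *
    \sum_(0 <= j < k.+1) prime_zeta (j.+1%:R * s) * almost_prime_zeta (k - j)%N s.
  apply: (@mulfI _ k.+1%:R); first by rewrite pnatr_eq0.
  rewrite mulVKf ?pnatr_eq0 // (almost_prime_zeta_newton hs) big_add1 /=.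
  by apply: eq_bigr => j _; rewrite subSS.
have P1 : almost_prime_zeta 1 s = prime_zeta s.
  by rewrite newton big_nat1 P0 mulr1 mul1r invr1 mul1r.
have [f2 f3 f4] : [/\ 2`! = 2, 3`! = 6 & 4`! = 24]%N by [].
have P2 : almost_prime_zeta 2 s =
    (prime_zeta (2 * s) + prime_zeta s ^+ 2) / (2`!)%:R.
  rewrite newton !big_nat_recl // big_geq //= !subn0 ?subSS P0 P1 !mul1r.
  by rewrite f2; field.
have P3 : almost_prime_zeta 3 s =
    (2 * prime_zeta (3 * s) + 3 * prime_zeta (2 * s) * prime_zeta s
     + prime_zeta s ^+ 3) / (3`!)%:R.
  rewrite newton !big_nat_recl // big_geq //= !subn0 ?subSS P0 P1 P2 !mul1r.
  by rewrite f2 f3; field.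
split=> [||| k _]; rewrite ?P2 ?P3 //; last exact: almost_prime_zeta_cycle_sum.
rewrite newton !big_nat_recl // big_geq //= !subn0 ?subSS P0 P1 P2 P3 !mul1r.
by rewrite f2 f3 f4; field.
Qed.
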